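(* Let $R$ be a (special) $\lambda$-ring. Then the Adams operations $\psi_n$, $n\in\mathbb{N}^\times$, turn $R$ into a sheaf of rings on the topos $\widehat{\mathbb{N}^\times}$, the monoid $\mathbb{N}^\times$ acting on $R$ by ring endomorphisms through $(n,x)\mapsto\psi_n(x)$.
   Context: $\mathbb{N}^\times$ is the multiplicative monoid of positive integers, and $\widehat{\mathbb{N}^\times}$ is the presheaf topos of sets with an action of $\mathbb{N}^\times$ (it underlies the Arithmetic Site); a sheaf of rings on it is a ring object, i.e. a ring on which $\mathbb{N}^\times$ acts by ring endomorphisms. All $\lambda$-rings considered are (commutative) special $\lambda$-rings in the terminology of Atiyah–Tall. The Adams operations $\psi_n:R\to R$ are defined in terms of the $\lambda$-operations $\lambda_n$ by the identity of formal power series $$\frac{t\,\partial_t\lambda(t)}{\lambda(t)}=\sum_{n\ge1}(-1)^{n-1}\psi_nt^n,\qquad\lambda(t)=\sum_{n\ge0}\lambda_nt^n,$$ so that $\psi_1=\lambda_1$, $\psi_2=\lambda_1^2-2\lambda_2$, $\psi_3=\lambda_1^3-3\lambda_2\lambda_1+3\lambda_3$, etc. *)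

(* Defs.v *)
From HB Require Import structures.
From mathcomp Require Import all_boot all_order all_fingroup all_algebra.
From mathcomp.multinomials Require Import mpoly.

Set Implicit Arguments.
Unset Strict Implicit.
Unset Printing Implicit Defensive.

From mathcomp Require Import zify.
Import GRing.Theory.
Local Open Scope ring_scope.

(* A formal power series over R is its sequence of coefficients. *)
Section FormalPowerSeries.
Variable R : comPzRingType.
Implicit Types f g : nat -> R.

Definition fps_one : nat -> R := fun n => (n == 0)%N%:R.

Definition fps_mul f g : nat -> R := fun n => \sum_(i < n.+1) f i * g (n - i)%N.

Definition fps_exp f k : nat -> R := iter k (fps_mul f) fps_one.

(* Inverse of a series with constant term 1: the geometric series            *)
(* sum_k (1 - f)^k, in which (1 - f)^k contributes nothing below degree k.   *)
Definition fps_inv f : nat -> R := fun n =>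
  \sum_(k < n.+1) fps_exp (fun i => fps_one i - f i) k n.

Definition fps_div f g := fps_mul f (fps_inv g).

(* t * d/dt *)
Definition fps_tderiv f : nat -> R := fun n => f n *+ n.

Lemma fps_expS_lt f k n : f 0%N = 0 -> (n < k)%N -> fps_exp f k n = 0.
Proof.
move=> f0; elim: k n => [//|k IHk] n ltnk; rewrite /fps_exp iterS -/(fps_exp f k).
apply: big1 => -[[|i] /= lti] _; first by rewrite f0 mul0r.
by rewrite IHk ?mulr0 //; lia.
Qed.

Lemma fps_mulfV f : f 0%N = 1 -> fps_mul f (fps_inv f) =1 fps_one.
Proof.
move=> f0 n; set u := fun i => fps_one i - f i.
have u0 : u 0%N = 0 by rewrite /u f0 subrr.
have one_mul (g : nat -> R) m : fps_mul fps_one g m = g m.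
  rewrite /fps_mul big_ord_recl subn0 mul1r big1 ?addr0 // => i _.
  by rewrite mul0r.
transitivity (\sum_(k < n.+1) fps_mul f (fps_exp u k) n).
  rewrite /fps_mul exchange_big /=; apply: eq_bigr => i _.
  rewrite /fps_inv mulr_sumr -/u.
  rewrite (big_ord_widen n.+1 (fun k => f i * fps_exp u k (n - i)%N)) ?ltnS ?leq_subr //.
  rewrite [RHS](bigID (fun k : 'I_n.+1 => (k < (n - i).+1)%N)) /=.
  rewrite [X in _ + X]big1 ?addr0; first exact: eq_bigl.
  by move=> k Hk; rewrite fps_expS_lt ?mulr0 // ltnNge -ltnS.
rewrite (eq_bigr (fun k : 'I_n.+1 => fps_exp u k n - fps_exp u k.+1 n)).
  rewrite -(big_mkord xpredT (fun k => fps_exp u k n - fps_exp u k.+1 n)).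
  rewrite (@telescope_sumr_eq _ 0 n.+1 (fun k => - fps_exp u k n)) // => [|k _].
    by rewrite (fps_expS_lt u0 (ltnSn n)) oppr0 sub0r opprK.
  by rewrite opprK addrC.
move=> k _; rewrite [fps_exp u k.+1]/(fps_mul u (fps_exp u k)).
rewrite -[fps_exp u k n]one_mul -sumrB; apply: eq_bigr => i _.
by rewrite -mulrBl /u opprB addrC subrK.
Qed.

End FormalPowerSeries.

(* The universal polynomials of the theory of lambda-rings. Variables are    *)
(* numbered from 0, so the variable of index i carries the (i+1)-st          *)
(* elementary symmetric function.                                            *)
Section UniversalPolynomials.

(* The i-th elementary symmetric function of the first, resp. last, n of the *)
(* indeterminates xi_0, ..., xi_(n-1), eta_0, ..., eta_(n-1).                *)
Definition esym_xi n i : {mpoly int[n + n]} :=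
  mesym n int i \mPo [tuple 'X_(lshift n j) | j < n].
Definition esym_eta n i : {mpoly int[n + n]} :=
  mesym n int i \mPo [tuple 'X_(rshift n j) | j < n].

(* P_n (s_1, ..., s_n; sigma_1, ..., sigma_n) is the coefficient of t^n in   *)
(* prod_(i, j) (1 + xi_i eta_j t).                                           *)
Definition mul_poly_spec n (P : {mpoly int[n + n]}) : bool :=
  P \mPo [tuple match split k with
                | inl i => esym_xi n i.+1
                | inr j => esym_eta n j.+1
                end | k < n + n]
  == (\prod_(i < n) \prod_(j < n)
        (1 + ('X_(lshift n i) * 'X_(rshift n j))%:P * 'X)
      : {poly {mpoly int[n + n]}})`_n.

(* P_(m, n) (s_1, ..., s_(m n)) is the coefficient of t^m in                 *)
(* prod_(i_1 < ... < i_n) (1 + xi_(i_1) ... xi_(i_n) t).                     *)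
Definition comp_poly_spec m n (P : {mpoly int[m * n]}) : bool :=
  P \mPo [tuple mesym (m * n) int i.+1 | i < m * n]
  == (\prod_(I : {set 'I_(m * n)} | #|I| == n)
        (1 + (\prod_(i in I) 'X_i)%:P * 'X)
      : {poly {mpoly int[m * n]}})`_m.


Arguments mul_poly_spec n P : clear implicits.
Arguments comp_poly_spec m n P : clear implicits.

Lemma mpoly_rmorph_ext n (A : comNzRingType) (S : nzRingType)
    (f g : {rmorphism {mpoly A[n]} -> S}) :
    (forall c, f c%:MP = g c%:MP) -> (forall i, f 'X_i = g 'X_i) -> f =1 g.
Proof.
move=> eqC eqX p; rewrite [p]mpolyE !rmorph_sum; apply: eq_bigr => m _.
rewrite -mul_mpolyC !rmorphM eqC mpolyXE_id !rmorph_prod; congr (_ * _).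
by apply: eq_bigr => i _; rewrite !rmorphXn /= eqX.
Qed.

Lemma prod_esym_eta n (z : {poly {mpoly int[n + n]}}) :
  \prod_(j < n) (1 + z * ('X_(rshift n j))%:P)
  = 1 + \sum_(k < n) z ^+ k.+1 * (esym_eta n k.+1)%:P.
Proof.
under eq_bigr => j _ do rewrite addrC.
rewrite bigA_distr /=.
transitivity (\sum_(k < n.+1) z ^+ k * (esym_eta n k)%:P).
  rewrite (partition_big (fun J : {set 'I_n} => inord #|J| : 'I_n.+1) xpredT) //=.
  apply: eq_bigr => k _; rewrite /esym_eta /mesym (raddf_sum (comp_mpoly _)).
  rewrite (raddf_sum polyC) mulr_sumr.
  apply: eq_big => [J|J /eqP Jk].
    rewrite -val_eqE /= inordK //.
    by rewrite ltnS (leq_trans (max_card _)) ?card_ord.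
  have cJ : #|J| = k.
    by rewrite -Jk inordK // ltnS (leq_trans (max_card _)) ?card_ord.
  rewrite -big_mkcond big_split /= prodr_const cJ; congr (_ * _).
  rewrite !rmorph_prod; apply: eq_bigr => j _.
  by rewrite /= comp_mpolyXU -tnth_nth tnth_mktuple.
rewrite big_ord_recl expr0 mul1r; congr (_ + _).
by rewrite /esym_eta mesym0E comp_mpoly1.
Qed.

Lemma mul_poly_exists n : exists P, mul_poly_spec n P.
Proof.
pose A := {mpoly int[n]}.
pose F : {poly {mpoly A[n]}} :=
  \prod_(i < n) (1 + \sum_(k < n) (('X_i)%:P * 'X) ^+ k.+1 * ('X_k : A)%:MP%:P).
have symF : F`_n \is symmetric.
  apply/issymP => s; rewrite -coef_map; congr (polyseq _)`_n.
  rewrite /F rmorph_prod [RHS](reindex_inj (@perm_inj _ s)) /=.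
  apply: eq_bigr => i _; rewrite rmorphD rmorph1 rmorph_sum; congr (_ + _).
  apply: eq_bigr => k _; rewrite rmorphM rmorphXn rmorphM /=.
  by rewrite !map_polyC map_polyX /= /msym mmapC mmapX mmap1U.
pose C := {mpoly int[n + n]}.
pose iota : {rmorphism A -> C} := mmap (@mpolyC (n + n) int) (fun j => 'X_(rshift n j)).
pose T : (n + n).-tuple C := [tuple match split k with
                | inl i => esym_xi n i.+1
                | inr j => esym_eta n j.+1
                end | k < n + n].
pose iotaT : {rmorphism A -> C} := comp_mpoly T \o iota.
pose theta : {rmorphism {mpoly A[n]} -> C} := mmap iotaT (fun i => 'X_(lshift n i)).
have iotaTE k : iotaT 'X_k = esym_eta n k.+1.
  rewrite /iotaT /= mmapX mmap1U comp_mpolyXU -tnth_nth tnth_mktuple.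
  by rewrite (unsplitK (inr k)).
exists (mmap iota (fun i => 'X_(lshift n i)) (symf F`_n)); apply/eqP.
transitivity (theta (symf F`_n \mPo [tuple mesym n A i.+1 | i < n])).
  pose f : {rmorphism {mpoly A[n]} -> C} :=
    comp_mpoly T \o mmap iota (fun i => 'X_(lshift n i)).
  pose g : {rmorphism {mpoly A[n]} -> C} :=
    theta \o comp_mpoly [tuple mesym n A i.+1 | i < n].
  apply: (mpoly_rmorph_ext (f := f) (g := g)) => [c|i] /=.
    by rewrite comp_mpolyC !mmapC.
  rewrite mmapX mmap1U !comp_mpolyXU -!tnth_nth !tnth_mktuple.
  rewrite (unsplitK (inl i)) /esym_xi /mesym !rmorph_sum; apply: eq_bigr => I _.
  rewrite !rmorph_prod; apply: eq_bigr => j _ /=.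
  by rewrite comp_mpolyXU -!tnth_nth !tnth_mktuple mmapX mmap1U.
rewrite -symfP // -coef_map rmorph_prod; congr (polyseq _)`_n; apply: eq_bigr => i _.
under [RHS]eq_bigr => j _ do rewrite polyCM mulrAC.
rewrite prod_esym_eta rmorphD rmorph1 rmorph_sum; congr (_ + _).
apply: eq_bigr => k _; rewrite rmorphM rmorphXn rmorphM /=.
by rewrite !map_polyC map_polyX /= mmapC mmapX mmap1U -iotaTE.
Qed.

Lemma comp_poly_exists m n : exists P, comp_poly_spec m n P.
Proof.
rewrite /comp_poly_spec; set N := (m * n)%N.
set F := (\prod_(I : {set 'I_N} | #|I| == n) (1 + (\prod_(i in I) 'X_i)%:P * 'X)
  : {poly {mpoly int[N]}}).
have symF : F`_m \is symmetric.
  apply/issymP => s; rewrite -coef_map; congr (polyseq _)`_m.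
  rewrite /F rmorph_prod [RHS](reindex_inj (imset_inj (@perm_inj _ s))) /=.
  apply: eq_big => [I|I _]; first by rewrite card_imset //; apply: perm_inj.
  rewrite rmorphD rmorph1 rmorphM /= map_polyC map_polyX /= rmorph_prod.
  rewrite big_imset /=; last by move=> ? ? _ _; apply: perm_inj.
  congr (1 + _%:P * 'X); apply: eq_bigr => i _.
  by rewrite /= /msym mmapX mmap1U.
by exists (symf F`_m); apply/eqP; rewrite -symfP.
Qed.

Definition mul_poly n : {mpoly int[n + n]} := xchoose (mul_poly_exists n).
Definition comp_poly m n : {mpoly int[m * n]} := xchoose (comp_poly_exists m n).

End UniversalPolynomials.

(* Value of an integer polynomial at elements of a ring which, unlike in     *)
(* mmap intr, may be the zero ring.                                          *)
Definition int_mpoly_eval (R : comPzRingType) n (v : 'I_n -> R)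
    (P : {mpoly int[n]}) : R :=
  \sum_(m <- msupp P) (\prod_(i < n) v i ^+ m i) *~ P@_m.

(* lam n is the operation lambda^n. *)
Record lambda_ring (R : comPzRingType) (lam : nat -> R -> R) : Prop := {
  lambda0 : forall x, lam 0%N x = 1;
  lambda1 : forall x, lam 1%N x = x;
  lambdaD : forall n x y,
    lam n (x + y) = \sum_(i < n.+1) lam i x * lam (n - i)%N y
}.

(* Special in the sense of Atiyah and Tall: lambda_t is a homomorphism of    *)
(* lambda-rings from R to the multiplicative group 1 + t R[[t]], endowed     *)
(* with the lambda-ring structure given by the universal polynomials.        *)
Record special_lambda_ring (R : comPzRingType) (lam : nat -> R -> R) : Prop := {
  special_lambda_ringW :> lambda_ring lam;
  lambda_one : forall n, lam n 1 = (n <= 1)%N%:R;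
  lambdaM : forall n x y,
    lam n (x * y) =
    int_mpoly_eval (fun k => match split k with
                             | inl i => lam i.+1 x
                             | inr j => lam j.+1 y
                             end) (mul_poly n);
  lambda_comp : forall m n x,
    lam m (lam n x) = int_mpoly_eval (fun i => lam i.+1 x) (comp_poly m n)
}.

(* psi_n is (-1)^(n-1) times the coefficient of t^n in the logarithmic       *)
(* derivative t lambda'(t) / lambda(t); only n >= 1 is meaningful.           *)
Definition adams (R : comPzRingType) (lam : nat -> R -> R) (n : nat) (x : R) : R :=
  (-1) ^+ n.-1 * fps_div (fps_tderiv (lam^~ x)) (lam^~ x) n.

(* The multiplicative monoid of positive integers. *)
Definition Nx : Type := {n : nat | (0 < n)%N}.
HB.instance Definition _ := Choice.on Nx.

Section NxMonoid.
Implicit Types m n p : Nx.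

Definition Nx_one : Nx := exist _ 1%N (ltn0Sn 0).

Lemma Nx_mul_subproof m n : (0 < val m * val n)%N.
Proof. by rewrite muln_gt0 (valP m) (valP n). Qed.

Definition Nx_mul m n : Nx := exist _ (val m * val n)%N (Nx_mul_subproof m n).

Lemma Nx_mulA : associative Nx_mul.
Proof. by move=> m n p; apply: val_inj; rewrite /= mulnA. Qed.

Lemma Nx_mul1n : left_id Nx_one Nx_mul.
Proof. by move=> n; apply: val_inj; rewrite /= mul1n. Qed.

Lemma Nx_muln1 : right_id Nx_one Nx_mul.
Proof. by move=> n; apply: val_inj; rewrite /= muln1. Qed.

End NxMonoid.

HB.instance Definition _ := isMonoid.Build Nx Nx_mulA Nx_mul1n Nx_muln1.

Definition monoid_action (M : monoidType) (X : Type) (act : M -> X -> X) : Prop :=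
  (forall x, act 1%g x = x) /\
  (forall m n x, act (m * n)%g x = act m (act n x)).

Definition ring_endomorphism (R : pzRingType) (f : R -> R) : Prop :=
  zmod_morphism f /\ GRing.monoid_morphism f.

(* A sheaf of rings on the topos of sets with an action of M, that is a ring *)
(* object of this topos.                                                     *)
Definition sheaf_of_rings (M : monoidType) (R : pzRingType) (act : M -> R -> R) : Prop :=
  monoid_action act /\ forall m, ring_endomorphism (act m).

(* Main.v *)
From HB Require Import structures.
From mathcomp Require Import all_boot all_algebra all_field.
From mathcomp.multinomials Require Import mpoly.
Require Import Defs.
From mathcomp Require Import zify ring.
Set Implicit Arguments.
Unset Strict Implicit.
Unset Printing Implicit Defensive.
Import GRing.Theory Num.Theory.
Local Open Scope ring_scope.

(** Write [psum f n] for (-1)^(n-1) times the coefficient of t^n in t f' / f, so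
    that [adams lam n x] is [psum] of the series lambda_t(x). If f is a finite
    product of factors 1 + a_i t, then [psum f n] is the power sum of the a_i, and
    this turns each claim on the psi_n into an evident one on power sums.

    Additivity holds because the logarithmic derivative is additive and
    lambda_t(x + y) = lambda_t(x) lambda_t(y); psi_n(1) = 1 because
    lambda_t(1) = 1 + t. For products, the axiom on lambda^k(x y) says that
    lambda_t(x y) is obtained from lambda_t(x) and lambda_t(y) by the universal
    polynomials P_k, so that the claim is a polynomial identity with integer
    coefficients, [psum_mul_series]. For composites, psi_m being a ring
    endomorphism gives psi_m(psi_n x) = [psum] (k |-> psi_m(lambda^k x)) n, and the
    axiom on lambda^j(lambda^k x) makes this a polynomial identity in the
    lambda^i(x), [psum_comp_series].

    A polynomial identity over the integers may be checked at the points of an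
    algebraically closed field of characteristic 0 ([universal_identity]). There
    every series with constant term 1 agrees, up to a given degree, with a product
    of linear factors ([series_roots]). The universal polynomials P_k and P_(m, n)
    are specified in a number of roots that varies with their indices, whereas one
    set of roots is wanted for all the indices at once. In characteristic 0 this
    discrepancy is harmless: Newton's identities show that the coefficients of a
    series up to degree n and its power sums up to n determine each other
    ([psum_local], [psum_inj]), and the power sums of the products involved only
    depend on those of the given series. With the roots a_i, b_j at hand the two
    identities read
      sum_(i, j) (a_i b_j)^n = (sum_i a_i^n) (sum_j b_j^n),
    and, since e_k(a_i^m) is the m-th power sum of the products of k distinct
    roots, p_n(a_i^m) = p_(m n)(a_i). *)

(** * Checking integral polynomial identities at complex points *)

Lemma muni_inj n (R : comNzRingType) : injective (@muni n R).
Proof.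
pose back q : {mpoly R[n.+1]} := (map_poly (@mwiden n R) q).['X_ord_max].
suff backK : cancel (@muni n R) back by exact: can_inj backK.
pose f : {rmorphism {mpoly R[n.+1]} -> {mpoly R[n.+1]}} :=
  horner_eval 'X_ord_max \o map_poly (@mwiden n R) \o @muni n R.
apply: (mpoly_rmorph_ext (f := f) (g := idfun)) => [c|i] /=.
  by rewrite muniC map_polyC /= horner_evalE hornerC mwidenC.
rewrite /muni mmapX mmap1U horner_evalE.
case: splitP => [j /= eqj|j /= eqj].
  rewrite map_polyC hornerC /= mwidenX mnmwiden1; congr 'X_ _.
  exact: val_inj.
rewrite map_polyX hornerX; congr 'X_ _.
by apply: val_inj; move: eqj; rewrite /= ord1 addn0.
Qed.

Lemma meval_muni n (R : comNzRingType) (p : {mpoly R[n.+1]}) (v : 'I_n -> R) x :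
  p.@[fun i => if unlift ord_max i is Some j then v j else x]
  = (map_poly (meval v) (muni p)).[x].
Proof.
set w := fun i => _.
pose g : {rmorphism {mpoly R[n.+1]} -> R} :=
  horner_eval x \o map_poly (meval v) \o @muni n R.
apply: (mpoly_rmorph_ext (f := meval w) (g := g)) => [c|i] /=.
  by rewrite mevalC muniC map_polyC /= horner_evalE hornerC mevalC.
rewrite mevalXU /muni mmapX mmap1U horner_evalE /w.
case: unliftP => [j ->|->]; case: splitP => [k /= eqk|k /= eqk].
- rewrite map_polyC hornerC /= mevalXU; congr (v _); apply: val_inj.
  by rewrite /= -eqk /bump leqNgt (ltn_ord j).
- by move: eqk (ltn_ord j); rewrite ord1 /bump /=; case: leqP => /=; lia.
- by have := ltn_ord k; lia.
by rewrite map_polyX hornerX.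
Qed.

(** Induction on the number of variables: read as a polynomial in the last
    variable and specialized in the others, it has all integers as roots. *)
Lemma int_mpoly_eq0 n (p : {mpoly int[n]}) : (forall v, p.@[v] = 0) -> p = 0.
Proof.
elim: n p => [|n IHn] p p0.
  by have := p0 (fun=> 0); rewrite (nvar0_mpolyC p) mevalC => ->.
apply: muni_inj; rewrite muni0; apply/polyP => k; rewrite coef0.
apply: IHn => v.
pose q := map_poly (meval v) (muni p).
suff q0 : q = 0 by have := coef_map (meval v) (muni p) k; rewrite -/q q0 coef0.
apply: (@roots_geq_poly_eq0 _ _ [seq i%:Z | i <- iota 0 (size q)]).
- by apply/allP => _ /mapP[i _ ->]; rewrite /root -meval_muni p0.
- by rewrite map_inj_uniq ?iota_uniq // => i j [].
by rewrite size_map size_iota.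
Qed.

(** An operation that is natural in the ring is determined by its value on the
    indeterminates of a polynomial ring over the integers, and two integral
    polynomials that agree at all integer points, hence a fortiori at all complex
    algebraic points, are equal. Operations are families indexed by the rings,
    rather than polynomials, so that [psum] need not be written as a polynomial.
    The second vector [w] in the naturality hypotheses spares any appeal to
    functional extensionality. *)
Lemma universal_identity N (F G : forall R : comNzRingType, ('I_N -> R) -> R) :
  (forall (A B : comNzRingType) (phi : {rmorphism A -> B}) v w,
     (forall i, phi (v i) = w i) -> phi (F A v) = F B w) ->
  (forall (A B : comNzRingType) (phi : {rmorphism A -> B}) v w,
     (forall i, phi (v i) = w i) -> phi (G A v) = G B w) ->
  (forall v, F algC v = G algC v) -> forall R v, F R v = G R v.
Proof.
move=> natF natG FG R v.
have FGZ w : F int w = G int w.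
  apply: (@intr_inj algC).
  pose z i : algC := (w i)%:~R.
  by rewrite (natF _ _ _ _ z) // (natG _ _ _ _ z).
pose X i : {mpoly int[N]} := 'X_i.
have FGX : F _ X = G _ X.
  apply/eqP; rewrite -subr_eq0; apply/eqP/int_mpoly_eq0 => w; rewrite mevalB.
  by rewrite (natF _ _ _ _ w) ?(natG _ _ _ _ w) ?FGZ ?subrr // => i; rewrite /= mevalXU.
pose phi : {rmorphism {mpoly int[N]} -> R} := mmap intr v.
have phiX i : phi (X i) = v i by rewrite /= mmapX mmap1U.
by rewrite -(natF _ _ phi _ _ phiX) FGX (natG _ _ phi _ _ phiX).
Qed.

(** * Power sums of a series *)

Definition psum (R : comPzRingType) (f : nat -> R) n : R :=
  (-1) ^+ n.-1 * fps_div (fps_tderiv f) f n.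

Lemma fps_mul_local (R : comPzRingType) (f f' g g' : nat -> R) n :
  (forall i, (i <= n)%N -> f i = f' i) -> (forall i, (i <= n)%N -> g i = g' i) ->
  forall i, (i <= n)%N -> fps_mul f g i = fps_mul f' g' i.
Proof.
move=> ff gg i lein; apply: eq_bigr => j _.
by rewrite ff ?gg //; have := ltn_ord j; lia.
Qed.

(** In degree n the truncated geometric series of [fps_inv] only involves the
    coefficients up to n. *)
Lemma psum_local (R : comPzRingType) (f g : nat -> R) n :
  (forall i, (i <= n)%N -> f i = g i) -> psum f n = psum g n.
Proof.
move=> fg; congr (_ * _); apply: (fps_mul_local (n := n)) => // i lein.
  by rewrite /fps_tderiv fg.
apply: eq_bigr => k _; move: (nat_of_ord k) => {}k; elim: k i lein => // k IHk.
by apply: fps_mul_local => // i lein; rewrite fg.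
Qed.

Lemma rmorph_fps_mul (R S : comPzRingType) (phi : {rmorphism R -> S}) f g n :
  phi (fps_mul f g n) = fps_mul (phi \o f) (phi \o g) n.
Proof. by rewrite rmorph_sum; apply: eq_bigr => i _; rewrite rmorphM. Qed.

Lemma rmorph_psum (R S : comPzRingType) (phi : {rmorphism R -> S}) f g n :
  (forall i, (i <= n)%N -> phi (f i) = g i) -> phi (psum f n) = psum g n.
Proof.
move=> fg; rewrite -(psum_local fg) rmorphM rmorphXn rmorphN1 rmorph_fps_mul.
congr (_ * _); apply: (fps_mul_local (n := n)) => // i _ /=.
  by rewrite rmorphMn.
rewrite rmorph_sum; apply: eq_bigr => k _.
move: (nat_of_ord k) => {}k; elim: k i => [|k IHk] i; first by rewrite rmorph_nat.
rewrite rmorph_fps_mul; apply: (fps_mul_local (n := i)) => // j _ /=.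
  by rewrite rmorphB rmorph_nat.
exact: IHk.
Qed.

Section LogDerivative.
Variable R : comNzRingType.
Implicit Types (f g d e : nat -> R) (p q : {poly R}).

Lemma coef_fps_mul p q n :
  (p * q)`_n = fps_mul (fun i => p`_i) (fun i => q`_i) n.
Proof. exact: coefM. Qed.

Lemma fps_mulC f g n : fps_mul f g n = fps_mul g f n.
Proof.
rewrite /fps_mul (reindex_inj rev_ord_inj) /=; apply: eq_bigr => i _.
by rewrite subSS subKn 1?mulrC // -ltnS.
Qed.

(** Associativity is inherited from polynomials by truncating the series beyond
    degree n. *)
Lemma fps_mulA f g h n : fps_mul f (fps_mul g h) n = fps_mul (fps_mul f g) h n.
Proof.
pose T f := \poly_(i < n.+1) f i.
have TE f' i : (i <= n)%N -> f' i = (T f')`_i by rewrite coef_poly ltnS => ->.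
have TM f' g' i : (i <= n)%N -> fps_mul f' g' i = (T f' * T g')`_i.
  by rewrite coef_fps_mul; apply: fps_mul_local; apply: TE.
transitivity (T f * (T g * T h))`_n.
  by rewrite coef_fps_mul; apply: (fps_mul_local (n := n)); [apply: TE | apply: TM |].
rewrite mulrA coef_fps_mul; apply: (fps_mul_local (n := n)) => // i lein.
  by rewrite -TM.
by rewrite -TE.
Qed.

Lemma fps_mulDr f d e n :
  fps_mul f (fun i => d i + e i) n = fps_mul f d n + fps_mul f e n.
Proof. by rewrite -big_split; apply: eq_bigr => i _; rewrite mulrDr. Qed.

Lemma fps_mul0 f g : fps_mul f g 0%N = f 0%N * g 0%N.
Proof. by rewrite /fps_mul big_ord1. Qed.

Lemma fps_mulf1 f n : fps_mul f (fps_one R) n = f n.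
Proof.
rewrite /fps_mul big_ord_recr /= subnn mulr1 big1 ?add0r // => i _.
by rewrite /fps_one subn_eq0 leqNgt ltn_ord mulr0.
Qed.

Lemma fps_mul_cancel f d e n : f 0%N = 1 ->
    (forall i, (i <= n)%N -> fps_mul f d i = fps_mul f e i) ->
  forall i, (i <= n)%N -> d i = e i.
Proof.
move=> f0 fde i; elim/ltn_ind: i => i IHi lein.
have := fde i lein; rewrite /fps_mul !big_ord_recl f0 !mul1r !subn0.
have -> : \sum_(j < i) f (lift ord0 j) * d (i - lift ord0 j)%N
        = \sum_(j < i) f (lift ord0 j) * e (i - lift ord0 j)%N.
  by apply: eq_bigr => j _; rewrite IHi //; have := ltn_ord j;
    rewrite /= /bump /=; lia.
exact: addIr.
Qed.

Lemma fps_mul_logderiv f n :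
  f 0%N = 1 -> fps_mul f (fps_div (fps_tderiv f) f) n = fps_tderiv f n.
Proof.
move=> f0; rewrite /fps_div.
have -> : fps_mul f (fps_mul (fps_tderiv f) (fps_inv f)) n =
          fps_mul (fps_tderiv f) (fps_mul f (fps_inv f)) n.
  rewrite !fps_mulA; apply: (fps_mul_local (n := n)) => // i _; exact: fps_mulC.
rewrite -[RHS]fps_mulf1; apply: (fps_mul_local (n := n)) => // i _.
exact: fps_mulfV.
Qed.

(** Newton's identities, f d = t f', characterize the logarithmic derivative. *)
Lemma logderiv_unique f d n : f 0%N = 1 ->
  (forall i, (i <= n)%N -> fps_mul f d i = fps_tderiv f i) ->
  fps_div (fps_tderiv f) f n = d n.
Proof.
move=> f0 fd; apply: (fps_mul_cancel (f := f) (n := n)) => // i lein.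
by rewrite fps_mul_logderiv ?fd.
Qed.

Lemma logderivE f n : fps_div (fps_tderiv f) f n = (-1) ^+ n.-1 * psum f n.
Proof. by rewrite /psum mulrA -exprMn mulrNN mulr1 expr1n mul1r. Qed.

Lemma psum0 f : f 0%N = 1 -> psum f 0%N = 0.
Proof.
move=> f0; rewrite /psum (logderiv_unique (d := fun=> 0)) ?mulr0 // => -[|//] _.
by rewrite fps_mul0 mulr0.
Qed.

Lemma psum1 f : f 0%N = 1 -> psum f 1%N = f 1%N.
Proof.
move=> f0; have := fps_mul_logderiv 1 f0.
rewrite /fps_mul big_ord_recl big_ord1 /= f0 mul1r subn0 /bump /= subnn.
by rewrite !logderivE psum0 // !mulr0 addr0 !mul1r.
Qed.

(** By the Leibniz rule, since t (f g)' = (f g) (t f' / f + t g' / g). *)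
Lemma psum_mul f g n : f 0%N = 1 -> g 0%N = 1 ->
  psum (fps_mul f g) n = psum f n + psum g n.
Proof.
move=> f0 g0; rewrite /psum -mulrDr; congr (_ * _).
set df := fps_div _ f; set dg := fps_div _ g.
apply: (logderiv_unique (d := fun i => df i + dg i)) => [|k _].
  by rewrite fps_mul0 f0 g0 mulr1.
rewrite fps_mulDr.
have -> : fps_mul (fps_mul f g) df k = fps_mul g (fps_tderiv f) k.
  transitivity (fps_mul g (fps_mul f df) k).
    by rewrite fps_mulA; apply: (fps_mul_local (n := k)) => // i _; exact: fps_mulC.
  by apply: (fps_mul_local (n := k)) => // i _; exact: fps_mul_logderiv.
have -> : fps_mul (fps_mul f g) dg k = fps_mul f (fps_tderiv g) k.
  rewrite -fps_mulA; apply: (fps_mul_local (n := k)) => // i _.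
  exact: fps_mul_logderiv.
rewrite fps_mulC -big_split /fps_tderiv -sumrMnl; apply: eq_bigr => i _ /=.
by rewrite mulrnAl mulrnAr -mulrnDr; congr (_ *+ _); have := ltn_ord i; lia.
Qed.

(** t a / (1 + a t) = - sum_(k > 0) (- a)^k t^k; below, [d] is this series. *)
Lemma psum_linear (a : R) n :
  (0 < n)%N -> psum (fun k => (1 + a%:P * 'X)`_k) n = a ^+ n.
Proof.
move=> n_gt0.
pose d k : R := (k != 0)%:R * ((-1) ^+ k.-1 * a ^+ k).
rewrite /psum (logderiv_unique (d := d)) /d => [||k _].
- by rewrite -lt0n n_gt0 mul1r mulrA -exprMn mulrNN mulr1 expr1n mul1r.
- by rewrite coefD coefC coefMX addr0.
have c j : (1 + a%:P * 'X)`_j = (j == 0)%:R + (j == 1)%:R * a.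
  rewrite coefD coefCM coefC coefX mulrC; by case: j.
rewrite /fps_mul /fps_tderiv c; case: k => [|k].
  by rewrite big_ord1 !mul0r mulr0.
rewrite big_ord_recl /= c subn0 mul0r addr0 !mul1r add0r.
case: k => [|k].
  by rewrite big_ord1 /= c subnn !mul0r mulr0 addr0 expr0 expr1 !mul1r mulr1n.
rewrite big_ord_recl big1 => [|i _]; last by rewrite c /bump /= add0r !mul0r.
rewrite c /bump /= !addn0 /= !mul0r mul0rn add0r addr0 subn1 /= !mul1r !exprS.
by ring.
Qed.

Lemma coef0_prod_linear (I : Type) (r : seq I) (P : pred I) (a : I -> R) :
  (\prod_(i <- r | P i) (1 + (a i)%:P * 'X))`_0 = 1.
Proof.
rewrite coef0_prod big1 // => i _.
by rewrite coefD coefC coefMX addr0.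
Qed.

Lemma psum_prod_linear (I : Type) (r : seq I) (P : pred I) (a : I -> R) n :
  (0 < n)%N ->
  psum (fun k => (\prod_(i <- r | P i) (1 + (a i)%:P * 'X))`_k) n
  = \sum_(i <- r | P i) a i ^+ n.
Proof.
move=> n_gt0; elim: r => [|i r IHr].
  rewrite !big_nil /psum (logderiv_unique (d := fun=> 0)) ?mulr0 ?coef1 // => k _.
  rewrite /fps_mul big1 => [|? _]; last by rewrite mulr0.
  by rewrite /fps_tderiv coef1; case: k => [|k]; rewrite ?mulr0n ?mul0rn.
rewrite !big_cons; case: ifP => // Pi; rewrite -IHr -psum_linear // -psum_mul.
- by apply: psum_local => k _; rewrite coefM.
- by rewrite coefD coefC coefMX addr0.
exact: coef0_prod_linear.
Qed.

Lemma coef_prod_linear (I : finType) (a : I -> R) k :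
  (\prod_i (1 + (a i)%:P * 'X))`_k
  = \sum_(J : {set I} | #|J| == k) \prod_(i in J) a i.
Proof.
under eq_bigr => i _ do rewrite addrC.
rewrite bigA_distr coef_sum [RHS]big_mkcond; apply: eq_bigr => J _.
rewrite -big_mkcond big_split /= prodr_const -rmorph_prod coefCM coefXn eq_sym.
by case: eqP; rewrite ?mulr1 ?mulr0.
Qed.

End LogDerivative.

(** In Newton's identities the coefficient f_i occurs with the factor i, which is
    cancelled in characteristic 0. *)
Lemma psum_inj (K : numDomainType) (f g : nat -> K) n :
    f 0%N = 1 -> g 0%N = 1 ->
    (forall i, (0 < i <= n)%N -> psum f i = psum g i) ->
  forall i, (i <= n)%N -> f i = g i.
Proof.
move=> f0 g0 fg; elim/ltn_ind => -[|i] IHi lein; first by rewrite f0.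
have {}fg j : (j <= n)%N -> psum f j = psum g j.
  by case: j => [|j] lejn; rewrite ?psum0 // fg.
apply: (@mulIf _ (i.+1%:R : K)); first by rewrite pnatr_eq0.
rewrite !mulr_natr -[LHS]/(fps_tderiv f _) -[RHS]/(fps_tderiv g _).
rewrite -!fps_mul_logderiv // /fps_mul big_ord_recr [RHS]big_ord_recr /= subnn.
rewrite !logderivE !psum0 // !mulr0 !addr0; apply: eq_bigr => j _.
rewrite !logderivE fg ?IHi //; have := ltn_ord j; lia.
Qed.

(** * Universal polynomials on series with known roots *)

(** The product of the series [s] and [t] in the lambda-ring 1 + t R[[t]]. *)
Definition mul_series (R : comPzRingType) (s t : nat -> R) n : R :=
  int_mpoly_eval (fun k : 'I_(n + n) => match split k with
                             | inl i => s i.+1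
                             | inr j => t j.+1
                             end) (mul_poly n).

(** The operation lambda^n on the series [s] in the lambda-ring 1 + t R[[t]]. The
    degree [m] comes last so that [comp_series s n] is a series. *)
Definition comp_series (R : comPzRingType) (s : nat -> R) n m : R :=
  int_mpoly_eval (fun i : 'I_(m * n) => s i.+1) (comp_poly m n).

(** The [a i] with [P i] are the roots of this series in the sense of the splitting
    principle; its coefficients are their elementary symmetric functions. *)
Definition root_series (R : comNzRingType) (I : finType) (P : pred I)
    (a : I -> R) k : R :=
  (\prod_(i | P i) (1 + (a i)%:P * 'X))`_k.

Lemma rmorph_int_mpoly_eval (R S : comPzRingType) (phi : {rmorphism R -> S})
    n (v : 'I_n -> R) (w : 'I_n -> S) P :
  (forall i, phi (v i) = w i) -> phi (int_mpoly_eval v P) = int_mpoly_eval w P.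
Proof.
move=> vw; rewrite /int_mpoly_eval rmorph_sum; apply: eq_bigr => m _.
rewrite rmorphMz rmorph_prod; congr (_ *~ _); apply: eq_bigr => i _.
by rewrite rmorphXn /= vw.
Qed.

Lemma eq_int_mpoly_eval (R : comPzRingType) n (v w : 'I_n -> R) P :
  v =1 w -> int_mpoly_eval v P = int_mpoly_eval w P.
Proof. exact: (@rmorph_int_mpoly_eval R R idfun). Qed.

Lemma mul_series_natural (R S : comPzRingType) (phi : {rmorphism R -> S})
    s t s' t' n :
  (forall i, (i <= n)%N -> phi (s i) = s' i) ->
  (forall i, (i <= n)%N -> phi (t i) = t' i) ->
  phi (mul_series s t n) = mul_series s' t' n.
Proof.
move=> ss tt; apply: rmorph_int_mpoly_eval => k.
by case: split => i; rewrite ?ss ?tt // ltn_ord.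
Qed.

Lemma comp_series_natural (R S : comPzRingType) (phi : {rmorphism R -> S}) s s' m n :
  (forall i, (i <= m * n)%N -> phi (s i) = s' i) ->
  phi (comp_series s n m) = comp_series s' n m.
Proof. by move=> ss; apply: rmorph_int_mpoly_eval => k; rewrite ss ?ltn_ord. Qed.

Lemma rmorph_comp_mpoly (S : comNzRingType) n k
    (phi : {rmorphism {mpoly int[k]} -> S}) (T : n.-tuple {mpoly int[k]}) P :
  phi (P \mPo T) = int_mpoly_eval (fun i => phi (tnth T i)) P.
Proof.
rewrite comp_mpolyE rmorph_sum; apply: eq_bigr => m _.
rewrite -mul_mpolyC rmorphM rmorph_prod mulrC /=.
under eq_bigr => i _ do rewrite rmorphXn /=.
rewrite -mulrzr; congr (_ * _).
by rewrite -[X in X%:MP]intz !rmorph_int.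
Qed.

Section Roots.
Variable R : comNzRingType.

Lemma root_series0 (I : finType) (P : pred I) (a : I -> R) : root_series P a 0%N = 1.
Proof. exact: coef0_prod_linear. Qed.

Lemma psum_root_series (I : finType) (P : pred I) (a : I -> R) n :
  (0 < n)%N -> psum (root_series P a) n = \sum_(i | P i) a i ^+ n.
Proof. exact: psum_prod_linear. Qed.

Lemma int_mpoly_evalE n (w : 'I_n -> R) P : int_mpoly_eval w P = mmap intr w P.
Proof. by apply: eq_bigr => m _; rewrite mulrzl. Qed.

Lemma int_mpoly_eval_mesym n (w : 'I_n -> R) k :
  int_mpoly_eval w (mesym n int k) = root_series xpredT w k.
Proof.
rewrite int_mpoly_evalE /root_series coef_prod_linear /mesym rmorph_sum.
apply: eq_bigr => J _; rewrite rmorph_prod; apply: eq_bigr => i _.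
by rewrite /= mmapX mmap1U.
Qed.

Lemma mul_series_roots n (a b : 'I_n -> R) :
  mul_series (root_series xpredT a) (root_series xpredT b) n
  = root_series xpredT (fun ij => a ij.1 * b ij.2) n.
Proof.
pose w k := match split k with inl i => a i | inr j => b j end.
pose phi : {rmorphism {mpoly int[n + n]} -> R} := mmap intr w.
have phil i : phi 'X_(lshift n i) = a i.
  by rewrite /= mmapX mmap1U /w (unsplitK (inl i)).
have phir i : phi 'X_(rshift n i) = b i.
  by rewrite /= mmapX mmap1U /w (unsplitK (inr i)).
have /eqP/(congr1 phi) := xchooseP (mul_poly_exists n).
rewrite rmorph_comp_mpoly -coef_map rmorph_prod -/(mul_poly n).
under eq_bigr => i _ do [rewrite rmorph_prod; under eq_bigr => j _ do
  rewrite rmorphD rmorph1 rmorphM /= map_polyX map_polyC /= rmorphM phil phir].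
rewrite pair_bigA /= => e; apply: etrans e; apply: eq_int_mpoly_eval => k.
rewrite tnth_mktuple; case: split => i;
  rewrite rmorph_comp_mpoly -int_mpoly_eval_mesym; apply: eq_int_mpoly_eval => j;
  by rewrite tnth_mktuple.
Qed.

Lemma comp_series_roots m n (a : 'I_(m * n) -> R) :
  comp_series (root_series xpredT a) n m
  = root_series (fun I : {set 'I_(m * n)} => #|I| == n)
      (fun I => \prod_(i in I) a i) m.
Proof.
pose phi : {rmorphism {mpoly int[m * n]} -> R} := mmap intr a.
have phiX i : phi 'X_i = a i by rewrite /= mmapX mmap1U.
have /eqP/(congr1 phi) := xchooseP (comp_poly_exists m n).
rewrite rmorph_comp_mpoly -coef_map rmorph_prod -/(comp_poly m n).
under eq_bigr => I _ do
  rewrite rmorphD rmorph1 rmorphM /= map_polyX map_polyC /= rmorph_prod.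
under eq_bigr => I _ do under eq_bigr => i _ do rewrite phiX.
move=> e; apply: etrans e; apply: eq_int_mpoly_eval => k.
rewrite tnth_mktuple -[phi _]int_mpoly_evalE int_mpoly_eval_mesym //.
Qed.

End Roots.

(** * The identities over an algebraically closed field *)

Section Points.
Variable K : numClosedFieldType.
Implicit Types (s t : nat -> K).

(** The reciprocal of the truncation of [s] at degree N is monic, so that it splits
    into N linear factors; the [a i] are the opposites of its roots. *)
Lemma series_roots s N : s 0%N = 1 ->
  exists a : 'I_N -> K, forall k, (k <= N)%N -> s k = root_series xpredT a k.
Proof.
move=> s0; pose p := \poly_(i < N.+1) s (N - i)%N.
have szp : size p = N.+1 by rewrite size_poly_eq // subnn s0 oner_eq0.
have lcp : lead_coef p = 1 by rewrite lead_coefE szp coef_poly ltnSn subnn s0.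
have [r] := closed_field_poly_normal p; rewrite lcp scale1r => pr.
have szr : size r == N by rewrite -eqSS -(size_prod_XsubC r id) -pr szp.
exists (fun i => - tnth (Tuple szr) i) => k lekN.
have /= := mroots_coeff (Tuple szr) (Ordinal (lekN : k < N.+1)%N).
rewrite -pr coef_poly ltnS leq_subr subKn // => ->.
rewrite /root_series coef_prod_linear /mesym rmorph_sum mulr_sumr.
apply: eq_bigr => J /eqP cJ; rewrite prodrN cJ rmorph_prod; congr (_ * _).
by apply: eq_bigr => i _; rewrite /= mevalXU.
Qed.

(** The l-th power sum of the a_i^m is the (m l)-th power sum of the a_i, which
    only involves the coefficients up to k m when l <= k. This compares two sets of
    roots of different sizes. *)
Lemma root_series_pow_eq (I J : finType) (a : I -> K) (b : J -> K) m k :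
  (0 < m)%N ->
  (forall i, (i <= k * m)%N -> root_series xpredT a i = root_series xpredT b i) ->
  root_series xpredT (fun i => a i ^+ m) k = root_series xpredT (fun i => b i ^+ m) k.
Proof.
move=> m_gt0 ab; apply: (psum_inj (n := k)); rewrite ?root_series0 // => l.
move=> /andP[l_gt0 lelk].
rewrite !psum_root_series //.
under eq_bigr do rewrite -exprM; under [RHS]eq_bigr do rewrite -exprM.
have ml_gt0 : (0 < m * l)%N by rewrite muln_gt0 m_gt0.
rewrite -!psum_root_series //; apply: psum_local => i lei; apply: ab.
by rewrite (leq_trans lei) // mulnC leq_mul2r lelk orbT.
Qed.

(** The roots [a] and [b] serve for all degrees up to n, the roots [a'] and [b']
    for the single degree k, in which P_k is specified with k roots. *)
Lemma psum_mul_series_closed s t n : s 0%N = 1 -> t 0%N = 1 -> (0 < n)%N ->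
  psum (mul_series s t) n = psum s n * psum t n.
Proof.
move=> s0 t0 n_gt0.
have [a sa] := series_roots n s0; have [b tb] := series_roots n t0.
have psumE k (I J : finType) (a' : I -> K) (b' : J -> K) : (0 < k)%N ->
    psum (root_series xpredT (fun ij : I * J => a' ij.1 * b' ij.2)) k
    = psum (root_series xpredT a') k * psum (root_series xpredT b') k.
  move=> k_gt0; rewrite !psum_root_series // mulr_suml.
  under [RHS]eq_bigr do rewrite mulr_sumr.
  by rewrite pair_bigA; apply: eq_bigr => ij _; rewrite exprMn.
rewrite (psum_local sa) (psum_local tb) -psumE //; apply: psum_local => k lekn.
have [a' sa'] := series_roots k s0; have [b' tb'] := series_roots k t0.
have -> : mul_series s t k
          = mul_series (root_series xpredT a') (root_series xpredT b') k.
  exact: (@mul_series_natural _ _ idfun).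
rewrite mul_series_roots.
apply: (psum_inj (n := k)); rewrite ?root_series0 // => i /andP[i_gt0 leik].
rewrite !psumE //; congr (_ * _); apply: psum_local => j leji.
  by rewrite -sa' -?sa //; lia.
by rewrite -tb' -?tb //; lia.
Qed.

(** The m-th power sum of lambda^k of the series with roots a_i is
    sum_(#|J| = k) (prod_(i in J) a_i)^m, that is the k-th elementary symmetric
    function of the a_i^m ([psumE] in the proof). The roots [b] are those for which
    P_(j, k) is specified. *)
Lemma psum_comp_series_closed s m n : s 0%N = 1 -> (0 < m)%N -> (0 < n)%N ->
  psum (fun k => psum (comp_series s k) m) n = psum s (m * n).
Proof.
move=> s0 m_gt0 n_gt0; have [a sa] := series_roots (m * n) s0.
have psumE j k (I : finType) (b : I -> K) : (0 < j)%N ->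
    psum (root_series (fun J : {set I} => #|J| == k) (fun J => \prod_(i in J) b i)) j
    = root_series xpredT (fun i => b i ^+ j) k.
  move=> j_gt0; rewrite psum_root_series // /root_series coef_prod_linear.
  by apply: eq_bigr => J _; rewrite prodrXl.
rewrite (psum_local sa) psum_root_series ?muln_gt0 ?m_gt0 //.
under [RHS]eq_bigr do rewrite exprM.
rewrite -psum_root_series //; apply: psum_local => k lekn.
rewrite -psumE //; apply: psum_local => j lejm.
have [b sb] := series_roots (j * k) s0.
have -> : comp_series s k j = comp_series (root_series xpredT b) k j.
  exact: (@comp_series_natural _ _ idfun).
rewrite comp_series_roots.
apply: (psum_inj (n := j)); rewrite ?root_series0 // => l /andP[l_gt0 lelj].
rewrite !psumE //; apply: root_series_pow_eq => // i lei.
have lekl : (k * l <= j * k)%N by rewrite mulnC leq_mul2r lelj orbT.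
have lejk : (j * k <= m * n)%N by apply: leq_mul.
by rewrite -sb -?sa //; lia.
Qed.

End Points.

(** * The identities over any commutative ring *)

(** The generic series of degree at most N with constant term 1, if the [v i] are
    indeterminates. *)
Definition var_series N (R : comNzRingType) (v : 'I_N -> R) k : R :=
  if k is i.+1 then if insub i is Some j then v j else 0 else 1.

Lemma var_seriesE N (R : comNzRingType) (s : nat -> R) k : s 0%N = 1 ->
  (k <= N)%N -> var_series (fun i : 'I_N => s i.+1) k = s k.
Proof. by move=> s0; case: k => // k ltk; rewrite /= insubT. Qed.

Lemma rmorph_var_series N (A B : comNzRingType) (phi : {rmorphism A -> B})
    (v : 'I_N -> A) (w : 'I_N -> B) k :
  (forall i, phi (v i) = w i) -> phi (var_series v k) = var_series w k.
Proof.
move=> vw; case: k => [|k] /=; first exact: rmorph1.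
by case: insub => [i|]; rewrite ?vw ?rmorph0.
Qed.

Section Universal.
Variable R : comNzRingType.
Implicit Types s t : nat -> R.

Lemma psum_mul_series s t n : s 0%N = 1 -> t 0%N = 1 -> (0 < n)%N ->
  psum (mul_series s t) n = psum s n * psum t n.
Proof.
move=> s0 t0 n_gt0.
pose l (A : comNzRingType) (v : 'I_(n + n) -> A) := var_series (v \o @lshift n n).
pose r (A : comNzRingType) (v : 'I_(n + n) -> A) := var_series (v \o @rshift n n).
pose F A v := psum (mul_series (l A v) (r A v)) n.
pose G A v := psum (l A v) n * psum (r A v) n.
pose v (k : 'I_(n + n)) := match split k with inl i => s i.+1 | inr j => t j.+1 end.
have lv k : (k <= n)%N -> l R v k = s k.
  move=> lekn; rewrite -(var_seriesE s0 lekn).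
  apply: (rmorph_var_series (phi := idfun)) => i.
  by rewrite /= /v (unsplitK (inl i)).
have rv k : (k <= n)%N -> r R v k = t k.
  move=> lekn; rewrite -(var_seriesE t0 lekn).
  apply: (rmorph_var_series (phi := idfun)) => i.
  by rewrite /= /v (unsplitK (inr i)).
rewrite -(psum_local lv) -(psum_local rv).
transitivity (F R v).
  apply: psum_local => k lekn; apply/esym.
  by apply: (@mul_series_natural _ _ idfun) => i leik /=; rewrite ?lv ?rv //; lia.
apply: (universal_identity (F := F) (G := G)) => [A B phi u w uw|A B phi u w uw|u].
- apply: rmorph_psum => k _; apply: mul_series_natural => i _;
    by apply: rmorph_var_series => j; apply: uw.
- by rewrite rmorphM; congr (_ * _); apply: rmorph_psum => k _;
    apply: rmorph_var_series => j; apply: uw.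
exact: psum_mul_series_closed.
Qed.

Lemma psum_comp_series s m n : s 0%N = 1 -> (0 < m)%N -> (0 < n)%N ->
  psum (fun k => psum (comp_series s k) m) n = psum s (m * n).
Proof.
move=> s0 m_gt0 n_gt0.
pose F (A : comNzRingType) (v : 'I_(m * n) -> A) :=
  psum (fun k => psum (comp_series (var_series v) k) m) n.
pose G (A : comNzRingType) (v : 'I_(m * n) -> A) := psum (var_series v) (m * n).
pose v (i : 'I_(m * n)) := s i.+1.
transitivity (F R v).
  apply/esym/psum_local => k lekn; apply: psum_local => j lejm.
  apply: (@comp_series_natural _ _ idfun) => i lei /=.
  by rewrite var_seriesE //; apply: (leq_trans lei); apply: leq_mul.
transitivity (G R v); last by apply: psum_local => i; apply: var_seriesE.
apply: (universal_identity (F := F) (G := G)) => [A B phi u w uw|A B phi u w uw|u].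
- apply: rmorph_psum => k _; apply: rmorph_psum => j _.
  apply: comp_series_natural => i _; exact: rmorph_var_series.
- by apply: rmorph_psum => k _; apply: rmorph_var_series.
exact: psum_comp_series_closed.
Qed.

End Universal.

(** * The Adams operations *)

Section Adams.
Variables (R : comNzRingType) (lam : nat -> R -> R).
Hypothesis special_lam : special_lambda_ring lam.

Lemma adams1 x : adams lam 1 x = x.
Proof.
by rewrite [LHS]psum1 ?(lambda1 special_lam) // (lambda0 special_lam).
Qed.

Section Endomorphism.
Variable n : nat.
Hypothesis n_gt0 : (0 < n)%N.

Lemma adamsD x y : adams lam n (x + y) = adams lam n x + adams lam n y.
Proof.
rewrite -[RHS]psum_mul ?(lambda0 special_lam) //; apply: psum_local => k _.
exact: (lambdaD special_lam).
Qed.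

Lemma adams_zmod_morphism : zmod_morphism (adams lam n).
Proof.
by move=> x y; apply: (addIr (adams lam n y)); rewrite -adamsD !subrK.
Qed.

Lemma adams_monoid_morphism : GRing.monoid_morphism (adams lam n).
Proof.
split=> [|x y].
  rewrite -[RHS](expr1n R n) -psum_linear //; apply: psum_local => k _.
  rewrite (lambda_one special_lam) coefD coefCM coef1 coefX mul1r.
  by case: k => [|[|k]]; rewrite ?addr0 ?add0r.
rewrite -[RHS]psum_mul_series ?(lambda0 special_lam) //.
by apply: psum_local => k _; rewrite (lambdaM special_lam).
Qed.

HB.instance Definition _ :=
  GRing.isZmodMorphism.Build R R (adams lam n) adams_zmod_morphism.
HB.instance Definition _ :=
  GRing.isMonoidMorphism.Build R R (adams lam n) adams_monoid_morphism.

Definition adams_rmorphism : {rmorphism R -> R} := adams lam n.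

End Endomorphism.

(** As a ring endomorphism, psi_m may be applied to the coefficients of the series
    lambda_t(x) before taking [psum]. *)
Lemma adams_comp m n x : (0 < m)%N -> (0 < n)%N ->
  adams lam m (adams lam n x) = adams lam (m * n) x.
Proof.
move=> m_gt0 n_gt0; rewrite -[RHS]psum_comp_series ?(lambda0 special_lam) //.
apply: (rmorph_psum (phi := adams_rmorphism m_gt0)) => k _.
apply: psum_local => j _; exact: (lambda_comp special_lam).
Qed.

Lemma adams_sheaf_of_rings :
  sheaf_of_rings (fun (n : Nx) (x : R) => adams lam (val n) x).
Proof.
split; [split=> [x|m n x] | move=> n; split].
- exact: adams1.
- by rewrite adams_comp ?(valP m) ?(valP n).
- exact: adams_zmod_morphism.
by apply: adams_monoid_morphism; apply: valP.
Qed.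

End Adams.

(** Polynomials are formed over nonzero rings, so the zero ring is set apart. *)
Definition nonzero_ring (R : comPzRingType) (R1 : (1 : R) != 0) : comNzRingType :=
  HB.pack_for comNzRingType R (GRing.PzSemiRing_isNonZero.Build R R1).

Theorem lemma2p6 (R : comPzRingType) (lam : nat -> R -> R)
    (special_lam : special_lambda_ring lam) :
  sheaf_of_rings (fun (n : Nx) (x : R) => adams lam (val n) x).
Proof.
have [R0|R1] := eqVneq (1 : R) 0.
  have triv (x y : R) : x = y by rewrite -[x]mul1r -[y]mul1r R0 !mul0r.
  by do ![split=> *|move=> *].
(* Once the structure of R is an explicit record, the ring underlying
   [nonzero_ring R1] is R by conversion. *)
case: R lam special_lam R1 => T c; destruct c => lam special_lam R1.
exact: (@adams_sheaf_of_rings (nonzero_ring R1) lam special_lam).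
Qed.
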